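(* Let $S\subseteq\mathbb{R}^n$, $D\subseteq\mathbb{R}^l$, $U\subseteq\mathbb{R}^{s}$, $\Theta\subseteq\mathbb{R}^q$ be non-empty sets, $Y\subseteq\mathbb{R}^k$, and let $f:D\times\Theta\times S\times U\to S$ and $h:D\times\Theta\times S\to\mathbb{R}^k$ be locally bounded mappings with $h(D\times\Theta\times S)\subseteq Y$. Let $\theta\in\Theta$ be fixed (the constant, unknown parameter vector), and consider the control system with output $$x(t+1)=f(d(t),\theta,x(t),u(t)),\qquad y(t)=h(d(t),\theta,x(t)),\qquad x(t)\in S,\ d(t)\in D,\ u(t)\in U .$$ Let $x^*\in S$, $u^*\in U$, $y^*\in h(D\times\{\theta\}\times S)$ satisfy $f(d,\theta,x^*,u^* )=x^*$ and $h(d,\theta,x^* )=y^*$ for all $d\in D$. For a positive integer $p$ and $t\ge p$ write $y^{(p)}(t)=(y(t-1),y(t-2),\ldots,y(t-p))$. Assume: (a) There is a mapping $k:\Theta\times Y\to U$ such that $x^*$ is Robustly Globally Exponentially Stable for the system $x^+=f(d,\theta,x,k(\theta,h(d,\theta,x)))$, $x\in S$, $d\in D$. (b) There exist a positive integer $p$, a set $A\subseteq Y^p$ which contains all $w\in Y^p$ in a neighborhood of $(y^*,\ldots,y^* )$, and a mapping $\Psi:Y\times A\to\Theta$ such that for every sequence $\{(d(t),\hat\theta(t))\in D\times\Theta\}_{t=0}^\infty$ and every $x_0\in S$, the solution $x(t)$ of the control system $x(t+1)=f(d(t),\theta,x(t),u(t))$, $y(t)=h(d(t),\theta,x(t))$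 with $u(t)=k(\hat\theta(t),y(t))$ and $x(0)=x_0$ satisfies $\theta=\Psi(y(t),y^{(p)}(t))$ for all $t\ge p$ with $y^{(p)}(t)\in A$. (c) There exists a positive integer $m$ such that for every sequence $\{(d(t),\hat\theta(t))\in D\times\Theta\}_{t=0}^\infty$ and every $x_0\in S$, the solution $x(t)$ of the control system $x(t+1)=f(d(t),\theta,x(t),u(t))$, $y(t)=h(d(t),\theta,x(t))$ with $u(t)=k(\hat\theta(t),y(t))$ and $x(0)=x_0$ has the property that for all $t\ge m+p$ there is some $i(t)\in\{0,1,\ldots,m\}$ with $y^{(p)}(t-i(t))\in A$. (d) The sets $f(D\times\Theta\times S\times U)$, $Y$ and $\Theta$ are bounded. (e) There exist a constant $L\ge0$ and neighborhoods $N_1\subseteq\mathbb{R}^n$ of $x^*$, $N_2\subseteq\mathbb{R}^k$ of $y^*$, $N_3\subseteq\mathbb{R}^q$ of $\theta$ such that $$\left|f(d,\theta,x,k(\hat\theta,h(d,\theta,x)))-x^*\right|+\left|h(d,\theta,x)-y^*\right|\le L|x-x^*|+L|\hat\theta-\theta|,$$ $$\left|\Psi(h(d,\theta,x),w)-\theta\right|\le L|x-x^*|+L\sum_{i=1}^p|w_i-y^*|$$ for all $x\in N_1\cap S$, $d\in D$, $\hat\theta\in N_3\cap\Theta$ and $w=(w_1,\ldots,w_p)\in A$ with $w_i\in N_2\cap Y$ ($i=1,\ldots,p$). Consider the closed loop of the control system $x(t+1)=f(d(t),\theta,x(t),u(t))$, $y(t)=h(d(t),\theta,x(t))$ with the dynamic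 feedback with state $(w,\hat\theta)$, $w=(w_1,\ldots,w_p)\in Y^p$, $\hat\theta\in\Theta$: $$w_1^+=y,\quad w_2^+=w_1,\ \ldots,\ w_p^+=w_{p-1},\qquad \hat\theta^+=\begin{cases}\hat\theta & \text{if } w\notin A\\ \Psi(y,w)&\text{if } w\in A\end{cases},\qquad u=k(\hat\theta,y).$$ Then: 1) There exist constants $M,\sigma>0$ such that for every sequence $\{d(i)\in D\}_{i=0}^\infty$ and every $(x_0,w_0,\hat\theta_0)\in S\times Y^p\times\Theta$, the solution $(x(t),w(t),\hat\theta(t))$ of the closed-loop system with $(x(0),w(0),\hat\theta(0))=(x_0,w_0,\hat\theta_0)$ satisfies, for all $t\ge0$, $$|x(t)-x^*|+\sum_{i=1}^p|w_i(t)-y^*|+|\hat\theta(t)-\theta|\le M\exp(-\sigma t)\left(|x(0)-x^*|+\sum_{i=1}^p|w_i(0)-y^*|+|\hat\theta(0)-\theta|\right).$$ 2) For every sequence $\{d(i)\in D\}_{i=0}^\infty$ and every $(x_0,w_0,\hat\theta_0)\in S\times Y^p\times\Theta$, the solution of the closed-loop system with $(x(0),w(0),\hat\theta(0))=(x_0,w_0,\hat\theta_0)$ satisfies $\hat\theta(t)=\theta$ for all $t\ge m+p+1$.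
   Context: $|\cdot|$ is the Euclidean norm; time $t$ ranges over the non-negative integers; $z^+$ denotes the value $z(t+1)$ at the next time step. Robust Global Exponential Stability (RGES): for a system $z^+=F(d,z)$ with $F:D\times X\to X$, $X\subseteq\mathbb{R}^n$, and $z^*\in X$ with $F(d,z^* )=z^*$ for all $d\in D$, the point $z^*$ is called Robustly Globally Exponentially Stable if there exist constants $M,\sigma>0$ such that for every $z_0\in X$ and every sequence $\{d_i\in D\}_{i=0}^\infty$, the solution of $z(t+1)=F(d_t,z(t))$, $z(0)=z_0$, satisfies $|z(t)-z^*|\le M\exp(-\sigma t)|z_0-z^*|$ for all $t\ge0$. A mapping is locally bounded if it maps bounded subsets of its domain to bounded sets. *)

(* Defs.v *)
From HB Require Import structures.
From mathcomp Require Import all_boot all_order all_algebra.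
From mathcomp Require Import all_classical all_reals all_analysis.

Set Implicit Arguments.
Unset Strict Implicit.
Unset Printing Implicit Defensive.

Import Order.TTheory GRing.Theory Num.Theory.
Import numFieldNormedType.Exports.

Local Open Scope classical_set_scope.
Local Open Scope ring_scope.

(* The library norm `|v| on 'rV[R]_n is the sup norm.  It induces the same
   topology and the same bounded sets, so [nbhs] and [bounded_set] can be used
   as they are, but quantitative estimates need the Euclidean norm. *)
Definition enorm (R : realType) (n : nat) (v : 'rV[R]_n) : R :=
  Num.sqrt (\sum_j v 0 j ^+ 2).

Definition locally_bounded_on (R : realType) (V W : normedModType R)
    (dom : set V) (f : V -> W) : Prop :=
  forall B : set V, B `<=` dom -> bounded_set B -> bounded_set (f @` B).

Definition RGES (R : realType) (T : Type) (n : nat) (D : set T)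
    (X : set 'rV[R]_n) (F : T * 'rV[R]_n -> 'rV[R]_n) (zs : 'rV[R]_n) : Prop :=
  [/\ set_fun (D `*` X) X F, X zs, (forall d, D d -> F (d, zs) = zs) &
    exists M sigma : R, [/\ 0 < M, 0 < sigma &
      forall (d : nat -> T) (z : nat -> 'rV[R]_n),
        (forall t, D (d t)) -> X (z 0%N) ->
        (forall t, z t.+1 = F (d t, z t)) ->
        forall t, enorm (z t - zs)
                  <= M * expR (- (sigma * t%:R)) * enorm (z 0%N - zs)]].

(* An element (w_1, ..., w_p) of (R^k)^p is the p x k matrix whose rows are the
   w_i, with w_(i+1) stored in row i. *)
Definition pow_set (R : realType) (p k : nat) (Y : set 'rV[R]_k) :
  set 'M[R]_(p, k) := [set w | forall i, Y (row i w)].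

(* (y(t-1), ..., y(t-p)); meaningful for p <= t only, the subtraction on nat
   being truncated. *)
Definition history (R : realType) (p k : nat) (y : nat -> 'rV[R]_k) (t : nat) :
  'M[R]_(p, k) := \matrix_(i < p) y (t - i.+1)%N.

(* (w_1, ..., w_p) |-> (y, w_1, ..., w_(p-1)); ord_pred i is i - 1 for i > 0. *)
Definition shift_in (R : realType) (p k : nat) (y : 'rV[R]_k)
    (w : 'M[R]_(p, k)) : 'M[R]_(p, k) :=
  \matrix_(i < p) (if i == 0%N :> nat then y else row (ord_pred i) w).

Section ControlSystem.
Context {R : realType} {n l s q k : nat}.
Variable f : 'rV[R]_l * 'rV[R]_q * 'rV[R]_n * 'rV[R]_s -> 'rV[R]_n.
Variable h : 'rV[R]_l * 'rV[R]_q * 'rV[R]_n -> 'rV[R]_k.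
Variable theta : 'rV[R]_q.

Definition control_solution (d : nat -> 'rV[R]_l) (u : nat -> 'rV[R]_s)
    (x : nat -> 'rV[R]_n) (y : nat -> 'rV[R]_k) : Prop :=
  forall t, x t.+1 = f (d t, theta, x t, u t) /\ y t = h (d t, theta, x t).

Definition closed_loop_solution (p : nat)
    (kappa : 'rV[R]_q * 'rV[R]_k -> 'rV[R]_s)
    (A : set 'M[R]_(p, k)) (Psi : 'rV[R]_k * 'M[R]_(p, k) -> 'rV[R]_q)
    (d : nat -> 'rV[R]_l) (x : nat -> 'rV[R]_n) (y : nat -> 'rV[R]_k)
    (w : nat -> 'M[R]_(p, k)) (thh : nat -> 'rV[R]_q) : Prop :=
  [/\ control_solution d (fun t => kappa (thh t, y t)) x y,
      forall t, w t.+1 = shift_in (y t) (w t) &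
      forall t, thh t.+1 = if w t \in A then Psi (y t, w t) else thh t].

End ControlSystem.

Definition loop_error (R : realType) (n p k q : nat)
    (xs : 'rV[R]_n) (ys : 'rV[R]_k) (theta : 'rV[R]_q)
    (x : 'rV[R]_n) (w : 'M[R]_(p, k)) (thh : 'rV[R]_q) : R :=
  enorm (x - xs) + \sum_(i < p) enorm (row i w - ys) + enorm (thh - theta).

(* Main.v *)
(* Two facts about the loop error E drive the proof.

   One step multiplies E by at most a constant C: for small E this is the local
   Lipschitz estimate of (e), which applies because the regressor then lies in
   A; for E bounded away from 0 it follows from the boundedness of the successor
   states.

   From time T = m + p + 1 on the parameter estimate is exact: after p steps the
   regressor is the true output history, by (c) it visits A at some time in
   [p, m + p], and by (b) the estimate becomes theta there and never leaves it.

   So from T on x solves the nominal loop of (a) and decays exponentially, the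
   outputs are bounded by C |x - x^*|, and from T + p on the regressor consists
   of such outputs only.  Before T + p the error grows by at most C^(T + p). *)

Require Import Defs.
From HB Require Import structures.
From mathcomp Require Import all_boot all_order all_algebra.
From mathcomp Require Import all_classical all_reals all_analysis.
From mathcomp Require Import ring lra zify.

Set Implicit Arguments.
Unset Strict Implicit.
Unset Printing Implicit Defensive.

Import Order.TTheory GRing.Theory Num.Theory.
Import numFieldNormedType.Exports.

Local Open Scope classical_set_scope.
Local Open Scope ring_scope.

Lemma enorm_ge0 (R : realType) (n : nat) (v : 'rV[R]_n) : 0 <= enorm v.
Proof. exact: sqrtr_ge0. Qed.

Lemma enorm0 (R : realType) (n : nat) : enorm (0 : 'rV[R]_n) = 0.
Proof.
by rewrite /enorm big1 ?sqrtr0// => j _; rewrite mxE expr0n.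
Qed.

Lemma abs_coord_le_enorm (R : realType) (n : nat) (v : 'rV[R]_n) (j : 'I_n) :
  `|v 0 j| <= enorm v.
Proof.
rewrite -sqrtr_sqr; apply: ler_wsqrtr.
by rewrite (bigD1 j)//= lerDl sumr_ge0// => i _; exact: sqr_ge0.
Qed.

Lemma enorm_le_sum (R : realType) (n : nat) (v : 'rV[R]_n) :
  enorm v <= \sum_j `|v 0 j|.
Proof.
have s0 : 0 <= \sum_j `|v 0 j| by exact: sumr_ge0.
rewrite -(ger0_norm s0) -sqrtr_sqr; apply: ler_wsqrtr.
rewrite expr2 mulr_suml ler_sum// => j _.
rewrite -real_normK ?num_real// expr2 ler_wpM2l//.
by rewrite (bigD1 j)//= lerDl sumr_ge0.
Qed.

(** Boundedness refers to the sup norm, which controls each coordinate; the Euclidean norm is at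
    most the sum of the absolute values of the coordinates. *)
Lemma bounded_set_enormB (R : realType) (n : nat) (B : set 'rV[R]_n)
    (c : 'rV[R]_n) :
  bounded_set B -> exists b : R, forall v, B v -> enorm (v - c) <= b.
Proof.
move=> Bb; have [b bB] : exists b, forall v, B v -> `|v| <= b.
  have [M [Mr bM]] := Bb; exists (M + 1) => v Bv; by apply: bM => //; rewrite ltrDl.
exists (\sum_(j < n) (b + `|c 0 j|)) => v Bv.
apply: le_trans (enorm_le_sum _) _; apply: ler_sum => j _.
rewrite !mxE (le_trans (ler_normB _ _))// lerD2r.
apply: le_trans (bB _ Bv).
rewrite [leRHS]mx_normrE.
exact: (le_bigmax _ (fun ij : 'I_1 * 'I_n => `|v ij.1 ij.2|) (0, j)).
Qed.

(** A ball of matrices is a condition on single entries, and an entry is at most the Euclidean norm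
    of its row. *)
Lemma nbhs_mx_enorm (R : realType) (p k : nat) (c : 'M[R]_(p, k))
    (N : set 'M[R]_(p, k)) :
  nbhs c N -> exists2 e : R, 0 < e &
    forall w, (forall i, enorm (row i w - row i c) < e) -> N w.
Proof.
move=> /nbhs_ballP[e /= e0 eN]; exists e => // w we; apply: eN; split=> // i j.
rewrite /ball/= distrC; apply: le_lt_trans (we i).
by apply: le_trans (abs_coord_le_enorm _ j); rewrite !mxE.
Qed.

Lemma nbhs_enorm (R : realType) (n : nat) (c : 'rV[R]_n) (N : set 'rV[R]_n) :
  nbhs c N -> exists2 e : R, 0 < e & forall v, enorm (v - c) < e -> N v.
Proof.
move=> /nbhs_mx_enorm[e e0 eN]; exists e => // v ve.
by apply: eN => i; rewrite !row_id.
Qed.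

(** Where [V] is at least [e], the constant [b] is at most [|b| / e] times [V]; elsewhere the local
    estimate applies. The summand 1 ensures [1 <= C], on which [geometric_growth] relies. *)
Lemma local_linear_bound (R : realType) (T : Type) (P : set T) (V W : T -> R)
    (e a b : R) : 0 < e -> (forall z, P z -> 0 <= V z) ->
  (forall z, P z -> V z < e -> W z <= a * V z) ->
  (forall z, P z -> W z <= b) ->
  exists2 C : R, 1 <= C & forall z, P z -> W z <= C * V z.
Proof.
move=> e0 V0 loc glob; exists (1 + `|a| + `|b| / e).
  by rewrite -addrA lerDl addr_ge0// divr_ge0// ltW.
move=> z Pz; have := V0 z Pz => Vz0; case: (ltP (V z) e) => Ve.
  apply: le_trans (loc z Pz Ve) _; apply: ler_wpM2r => //.
  rewrite -addrA addrCA (le_trans (ler_norm a))// lerDl.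
  by rewrite addr_ge0// divr_ge0// ltW.
apply: le_trans (glob z Pz) _; apply: le_trans (ler_norm b) _.
rewrite -[leLHS](divfK (lt0r_neq0 e0)).
apply: ler_pM => //; first by rewrite divr_ge0// ltW.
  exact: ltW.
by rewrite lerDr addr_ge0.
Qed.

(** [ord_pred] is cyclic and sends 0 to the last index. *)
Lemma ord_pred_pos (p : nat) (i : 'I_p) : (0 < i)%N -> ord_pred i = i.-1 :> nat.
Proof.
move=> i0; rewrite /= -subn1 -addnBAC// subn1 modnDr modn_small//.
exact: leq_ltn_trans (leq_pred _) (ltn_ord i).
Qed.

(** The oldest row is dropped and the others only change index. *)
Lemma sum_shift_in_le (R : realType) (p k : nat) (y ys : 'rV[R]_k)
    (w : 'M[R]_(p, k)) :
  \sum_(i < p) enorm (row i (shift_in y w) - ys)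
  <= enorm (y - ys) + \sum_(i < p) enorm (row i w - ys).
Proof.
case: p w => [|p] w; first by rewrite !big_ord0 addr0 enorm_ge0.
rewrite big_ord_recl rowK/= lerD2l big_ord_recr/=.
rewrite [leLHS](eq_bigr (fun i => enorm (row (widen_ord (leqnSn p) i) w - ys))).
  by rewrite lerDl enorm_ge0.
move=> i _; rewrite rowK/=; congr (enorm (row _ w - _)).
by apply: val_inj; rewrite [LHS]ord_pred_pos.
Qed.

Lemma head_shift_in_le (R : realType) (p k : nat) (y ys : 'rV[R]_k)
    (w : 'M[R]_(p, k)) : (0 < p)%N ->
  enorm (y - ys) <= \sum_(i < p) enorm (row i (shift_in y w) - ys).
Proof.
case: p w => // p w _; rewrite big_ord_recl rowK/= lerDl.
by apply: sumr_ge0 => i _; exact: enorm_ge0.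
Qed.

Lemma shift_in_pow_set (R : realType) (p k : nat) (Y : set 'rV[R]_k)
    (y : 'rV[R]_k) (w : 'M[R]_(p, k)) :
  Y y -> pow_set Y w -> pow_set Y (shift_in y w).
Proof. by move=> Yy Yw i; rewrite rowK; case: ifP. Qed.

(** Each step refills row 0 and moves the other rows on by one index, so row [i] holds initial data
    only while [t <= i]. *)
Lemma row_shift_register (R : realType) (p k : nat) (y : nat -> 'rV[R]_k)
    (w : nat -> 'M[R]_(p, k)) :
  (forall t, w t.+1 = shift_in (y t) (w t)) ->
  forall t (i : 'I_p), (i < t)%N -> row i (w t) = y (t - i.+1)%N.
Proof.
move=> wS; elim=> // t IH i it; rewrite wS rowK subSS.
case: ifPn => [/eqP ->|i0]; first by rewrite subn0.
rewrite -lt0n in i0.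
by rewrite IH ord_pred_pos ?prednK// -ltnS prednK.
Qed.

Lemma shift_register_history (R : realType) (p k : nat) (y : nat -> 'rV[R]_k)
    (w : nat -> 'M[R]_(p, k)) :
  (forall t, w t.+1 = shift_in (y t) (w t)) ->
  forall t, (p <= t)%N -> w t = history p y t.
Proof.
move=> wS t pt; apply/row_matrixP => i; rewrite rowK.
by apply: row_shift_register => //; exact: leq_trans pt.
Qed.

Lemma loop_error_ge0 (R : realType) (n p k q : nat) (xs : 'rV[R]_n)
    (ys : 'rV[R]_k) (theta : 'rV[R]_q) (x : 'rV[R]_n) (w : 'M[R]_(p, k))
    (thh : 'rV[R]_q) : 0 <= loop_error xs ys theta x w thh.
Proof.
rewrite /loop_error !addr_ge0 ?enorm_ge0// sumr_ge0// => i _.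
exact: enorm_ge0.
Qed.

(** As [1 <= C], the largest power covers all earlier times. *)
Lemma geometric_growth (R : realType) (E : nat -> R) (C : R) :
  1 <= C -> (forall t, 0 <= E t) -> (forall t, E t.+1 <= C * E t) ->
  forall T t, (t <= T)%N -> E t <= C ^+ T * E 0%N.
Proof.
move=> C1 E0 ES T t tT; have C0 : 0 <= C by exact: le_trans C1.
apply: (@le_trans _ _ (C ^+ t * E 0%N)); last first.
  by rewrite ler_wpM2r// ler_weXn2l.
elim: t {tT} => [|t IH]; first by rewrite expr0 mul1r.
by rewrite (le_trans (ES t))// exprS -mulrA ler_wpM2l.
Qed.

Theorem theorem2p1 (R : realType) (n l s q k : nat)
  (S : set 'rV[R]_n) (D : set 'rV[R]_l) (U : set 'rV[R]_s)
  (Theta : set 'rV[R]_q) (Y : set 'rV[R]_k)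
  (f : 'rV[R]_l * 'rV[R]_q * 'rV[R]_n * 'rV[R]_s -> 'rV[R]_n)
  (h : 'rV[R]_l * 'rV[R]_q * 'rV[R]_n -> 'rV[R]_k)
  (S0 : S !=set0) (D0 : D !=set0) (U0 : U !=set0) (Theta0 : Theta !=set0)
  (fS : set_fun (D `*` Theta `*` S `*` U) S f)
  (f_lb : locally_bounded_on (D `*` Theta `*` S `*` U) f)
  (h_lb : locally_bounded_on (D `*` Theta `*` S) h)
  (hY : h @` (D `*` Theta `*` S) `<=` Y)
  (theta : 'rV[R]_q) (thetaP : Theta theta)
  (xs : 'rV[R]_n) (us : 'rV[R]_s) (ys : 'rV[R]_k)
  (xsS : S xs) (usU : U us) (ysP : (h @` (D `*` [set theta] `*` S)) ys)
  (f_eq : forall d, D d -> f (d, theta, xs, us) = xs)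
  (h_eq : forall d, D d -> h (d, theta, xs) = ys)
  (kappa : 'rV[R]_q * 'rV[R]_k -> 'rV[R]_s)
  (kappaU : set_fun (Theta `*` Y) U kappa)
  (Ha : RGES D S
          (fun dx => f (dx.1, theta, dx.2, kappa (theta, h (dx.1, theta, dx.2))))
          xs)
  (p : nat) (p_gt0 : (0 < p)%N)
  (A : set 'M[R]_(p, k)) (AY : A `<=` pow_set Y)
  (A_nbhs : exists2 N : set 'M[R]_(p, k),
      nbhs (\matrix_(i < p) ys) N & N `&` pow_set Y `<=` A)
  (Psi : 'rV[R]_k * 'M[R]_(p, k) -> 'rV[R]_q)
  (PsiTheta : set_fun (Y `*` A) Theta Psi)
  (Hb : forall (d : nat -> 'rV[R]_l) (thh : nat -> 'rV[R]_q)
      (x : nat -> 'rV[R]_n) (y : nat -> 'rV[R]_k),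
    (forall t, D (d t)) -> (forall t, Theta (thh t)) -> S (x 0%N) ->
    control_solution f h theta d (fun t => kappa (thh t, y t)) x y ->
    forall t, (p <= t)%N -> A (history p y t) ->
      theta = Psi (y t, history p y t))
  (m : nat) (m_gt0 : (0 < m)%N)
  (Hc : forall (d : nat -> 'rV[R]_l) (thh : nat -> 'rV[R]_q)
      (x : nat -> 'rV[R]_n) (y : nat -> 'rV[R]_k),
    (forall t, D (d t)) -> (forall t, Theta (thh t)) -> S (x 0%N) ->
    control_solution f h theta d (fun t => kappa (thh t, y t)) x y ->
    forall t, (m + p <= t)%N ->
      exists2 i : nat, (i <= m)%N & A (history p y (t - i)%N))
  (f_bd : bounded_set (f @` (D `*` Theta `*` S `*` U)))
  (Y_bd : bounded_set Y) (Theta_bd : bounded_set Theta)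
  (L : R) (L_ge0 : 0 <= L)
  (N1 : set 'rV[R]_n) (N2 : set 'rV[R]_k) (N3 : set 'rV[R]_q)
  (N1_nbhs : nbhs xs N1) (N2_nbhs : nbhs ys N2) (N3_nbhs : nbhs theta N3)
  (He : forall (x : 'rV[R]_n) (d : 'rV[R]_l) (thh : 'rV[R]_q)
      (w : 'M[R]_(p, k)),
    (N1 `&` S) x -> D d -> (N3 `&` Theta) thh ->
    A w -> (forall i, (N2 `&` Y) (row i w)) ->
    enorm (f (d, theta, x, kappa (thh, h (d, theta, x))) - xs)
      + enorm (h (d, theta, x) - ys)
      <= L * enorm (x - xs) + L * enorm (thh - theta) /\
    enorm (Psi (h (d, theta, x), w) - theta)
      <= L * enorm (x - xs) + L * \sum_(i < p) enorm (row i w - ys)) :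
  (exists M sigma : R, [/\ 0 < M, 0 < sigma &
    forall (d : nat -> 'rV[R]_l) (x : nat -> 'rV[R]_n) (y : nat -> 'rV[R]_k)
        (w : nat -> 'M[R]_(p, k)) (thh : nat -> 'rV[R]_q),
      (forall t, D (d t)) ->
      S (x 0%N) -> pow_set Y (w 0%N) -> Theta (thh 0%N) ->
      closed_loop_solution f h theta kappa A Psi d x y w thh ->
      forall t,
        loop_error xs ys theta (x t) (w t) (thh t)
        <= M * expR (- (sigma * t%:R))
           * loop_error xs ys theta (x 0%N) (w 0%N) (thh 0%N)])
  /\
  (forall (d : nat -> 'rV[R]_l) (x : nat -> 'rV[R]_n) (y : nat -> 'rV[R]_k)
      (w : nat -> 'M[R]_(p, k)) (thh : nat -> 'rV[R]_q),
    (forall t, D (d t)) ->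
    S (x 0%N) -> pow_set Y (w 0%N) -> Theta (thh 0%N) ->
    closed_loop_solution f h theta kappa A Psi d x y w thh ->
    forall t, (m + p + 1 <= t)%N -> thh t = theta).
Proof.

(* Invariance of the state space under the closed loop *)
have YH d x th : D d -> Theta th -> S x -> Y (h (d, th, x)).
  by move=> Dd Tt Sx; apply: hY; exists (d, th, x); do ?split.
have SF d x u : D d -> S x -> U u -> S (f (d, theta, x, u)).
  by move=> Dd Sx Uu; apply: fS; split.
have UK th y : Theta th -> Y y -> U (kappa (th, y)).
  by move=> Tt Yy; apply: kappaU; split.
have Yys : Y ys by case: ysP => -[[d th] x] [[/= Dd ->] Sx] <-; exact: YH.
have TU w th y : Theta th -> Y y -> Theta (if w \in A then Psi (y, w) else th).
  by move=> Tt Yy; case: ifPn => // /set_mem Aw; apply: PsiTheta; split.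
have inv d x y w thh : (forall t, D (d t)) ->
    S (x 0%N) -> pow_set Y (w 0%N) -> Theta (thh 0%N) ->
    closed_loop_solution f h theta kappa A Psi d x y w thh ->
    forall t, [/\ S (x t), pow_set Y (w t) & Theta (thh t)].
  move=> Dd Sx Yw Tt [sol wS thS]; elim=> // t [Sxt Ywt Ttt].
  have [xS yE] := sol t; have Yyt : Y (y t) by rewrite yE; exact: YH.
  split; first by rewrite xS; apply: SF => //; exact: UK.
    by rewrite wS; exact: shift_in_pow_set.
  by rewrite thS; exact: TU.

(* Identification of the parameter in finite time *)
have exact_estimate d x y w thh : (forall t, D (d t)) ->
    S (x 0%N) -> pow_set Y (w 0%N) -> Theta (thh 0%N) ->
    closed_loop_solution f h theta kappa A Psi d x y w thh ->
    forall t, (m + p + 1 <= t)%N -> thh t = theta.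
  move=> Dd Sx Yw Tt cl; have I := inv _ _ _ _ _ Dd Sx Yw Tt cl.
  have [sol wS thS] := cl.
  have TT t : Theta (thh t) by have [] := I t.
  have hit t : (p <= t)%N -> A (w t) -> thh t.+1 = theta.
    move=> pt Aw; have wE := shift_register_history wS pt.
    rewrite thS mem_set// wE; symmetry; apply: (Hb _ _ _ _ Dd TT Sx sol _ pt).
    by rewrite -wE.
  (* At time [m + p], going back by [i <= m] still leaves a time of at least [p]. *)
  have [i im Ai] := Hc _ _ _ _ Dd TT Sx sol _ (leqnn (m + p)%N).
  have pi : (p <= m + p - i)%N by rewrite -addnBAC// leq_addl.
  rewrite -(shift_register_history wS pi) in Ai.
  (* Each later step either evaluates [Psi] in [A], where [hit] applies again, or keeps the
     estimate. *)
  have stay j : thh (m + p - i + j).+1 = theta.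
    elim: j => [|j IH]; first by rewrite addn0; exact: hit.
    rewrite addnS; have [Aw|nAw] := pselect (A (w (m + p - i + j).+1)).
      by apply: hit => //; rewrite (leq_trans pi)// -addnS leq_addr.
    by rewrite thS memNset.
  move=> t; rewrite addn1; case: t => // t; rewrite ltnS => tmp.
  have /subnKC <- : (m + p - i <= t)%N by exact: leq_trans (leq_subr _ _) tmp.
  exact: stay.
split; last exact: exact_estimate.

(* Linear one-step bound on the loop error *)
have [C C1 step] : exists2 C : R, 1 <= C & forall x w th d,
    S x -> pow_set Y w -> Theta th -> D d ->
    loop_error xs ys theta (f (d, theta, x, kappa (th, h (d, theta, x))))
      (shift_in (h (d, theta, x)) w)
      (if w \in A then Psi (h (d, theta, x), w) else th)
    <= C * loop_error xs ys theta x w th.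
  have [e1 e1_gt0 e1N] := nbhs_enorm N1_nbhs.
  have [e2 e2_gt0 e2N] := nbhs_enorm N2_nbhs.
  have [e3 e3_gt0 e3N] := nbhs_enorm N3_nbhs.
  have [NA /nbhs_mx_enorm[e4 e4_gt0 e4N] NAA] := A_nbhs.
  (* A loop error below [e] puts the state, the regressor rows and the estimate in [N1], [N2] and
     [N3], and the regressor in [A]. *)
  pose e := Num.min (Num.min e1 e2) (Num.min e3 e4).
  have e_gt0 : 0 < e by rewrite !lt_min e1_gt0 e2_gt0 e3_gt0 e4_gt0.
  have [bX bXP] := bounded_set_enormB xs f_bd.
  have [bY bYP] := bounded_set_enormB ys Y_bd.
  have [bT bTP] := bounded_set_enormB theta Theta_bd.
  pose P : set ('rV[R]_n * 'M[R]_(p, k) * 'rV[R]_q * 'rV[R]_l) :=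
    S `*` pow_set Y `*` Theta `*` D.
  pose V (z : 'rV[R]_n * 'M[R]_(p, k) * 'rV[R]_q * 'rV[R]_l) :=
    let: (x, w, th, d) := z in loop_error xs ys theta x w th.
  pose W (z : 'rV[R]_n * 'M[R]_(p, k) * 'rV[R]_q * 'rV[R]_l) :=
    let: (x, w, th, d) := z in
    loop_error xs ys theta (f (d, theta, x, kappa (th, h (d, theta, x))))
      (shift_in (h (d, theta, x)) w)
      (if w \in A then Psi (h (d, theta, x), w) else th).
  (* The first [L] bounds the new state and output errors together, the 1 accounts for the old
     regressor rows, and the last [L] for the value of [Psi]. *)
  have [|||C C1 CP] := @local_linear_bound R _ P V W e (L + 1 + L)
    (bX + \sum_(i < p) bY + bT) e_gt0.
  - by move=> [[[x w] th] d] _; exact: loop_error_ge0.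
  - move=> [[[x w] th] d] [[[/= Sx Yw] Tt] Dd].
    rewrite /loop_error; set ew := \sum_(i < p) _ => Ve.
    have ew0 : 0 <= ew by apply: sumr_ge0 => i _; exact: enorm_ge0.
    have ex0 := enorm_ge0 (x - xs); have et0 := enorm_ge0 (th - theta).
    have [ee1 ee2 ee3 ee4] : [/\ e <= e1, e <= e2, e <= e3 & e <= e4].
      by split; rewrite /e !ge_min lexx ?orbT.
    have ewi i : enorm (row i w - ys) <= ew.
      rewrite /ew (bigD1 i)//= lerDl.
      by apply: sumr_ge0 => j _; exact: enorm_ge0.
    have Aw : A w.
      apply: NAA; split=> //; apply: e4N => i; rewrite rowK.
      by have := ewi i; lra.
    rewrite mem_set//.
    have [] := He x d th w.
    + by split=> //; apply: e1N; lra.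
    + by [].
    + by split=> //; apply: e3N; lra.
    + by [].
    + by move=> i; split; [apply: e2N; have := ewi i; lra|exact: Yw].
    have := sum_shift_in_le (h (d, theta, x)) ys w.
    rewrite -/ew => sh fhle Ple.
    have : 0 <= L * enorm (th - theta) by exact: mulr_ge0.
    have : 0 <= L * ew by exact: mulr_ge0.
    have : 0 <= L * enorm (x - xs) by exact: mulr_ge0.
    by rewrite -/ew in Ple; lra.
  - move=> [[[x w] th] d] [[[/= Sx Yw] Tt] Dd].
    have Yy := YH _ _ _ Dd thetaP Sx.
    rewrite /loop_error lerD//; last by apply: bTP; exact: TU.
    rewrite lerD//.
      apply: bXP; exists (d, theta, x, kappa (th, h (d, theta, x))) => //.
      by split=> //; exact: UK.
    apply: ler_sum => i _; apply: bYP; exact: shift_in_pow_set.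
  exists C => // x w th d Sx Yw Tt Dd.
  by apply: (CP (x, w, th, d)); split.
have C_ge0 : 0 <= C by exact: le_trans C1.
(* One step from the state (x, (ys, ..., ys), theta) brings the output into the
   regressor, so [step] also bounds the output error. *)
have out d x : S x -> D d -> enorm (h (d, theta, x) - ys) <= C * enorm (x - xs).
  move=> Sx Dd; have := step x (\matrix_(i < p) ys) theta d Sx _ thetaP Dd.
  rewrite {2}/loop_error subrr enorm0 addr0 big1 ?addr0; last first.
    by move=> i _; rewrite rowK subrr enorm0.
  have Yc : pow_set Y (\matrix_(i < p) ys) by move=> i; rewrite rowK.
  move=> /(_ Yc); apply: le_trans.
  apply: le_trans (head_shift_in_le _ _ (\matrix_(i < p) ys) p_gt0) _.
  by rewrite /loop_error addrAC lerDr addr_ge0 ?enorm_ge0.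

(* Exponential decay of the loop error *)
have [_ _ _ [M [sigma [M_gt0 sigma_gt0 HM]]]] := Ha.
pose T := (m + p + 1)%N.
(* [M] is for the state and [p * C * M] for the [p] stored outputs; the final 1 makes [K >= 1], as
   needed up to time [T + p]. *)
pose K := M * (1 + p%:R * C) + 1.
have K_gt0 : 0 < K.
  by rewrite ltr_wpDl// mulr_ge0 ?addr_ge0 ?mulr_ge0// ltW.
exists (K * C ^+ (T + p) * expR (sigma * (T + p)%:R)), sigma.
split=> //; first by rewrite !mulr_gt0 ?expR_gt0// exprn_gt0// (lt_le_trans _ C1).
move=> d x y w thh Dd Sx Yw Tt cl.
have I := inv _ _ _ _ _ Dd Sx Yw Tt cl.
have est := exact_estimate _ _ _ _ _ Dd Sx Yw Tt cl.
have [sol wS thS] := cl.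
pose E t := loop_error xs ys theta (x t) (w t) (thh t).
have E_ge0 t : 0 <= E t by exact: loop_error_ge0.
have growth : forall N t, (t <= N)%N -> E t <= C ^+ N * E 0%N.
  apply: geometric_growth => // t; have [Sxt Ywt Ttt] := I t.
  have [xS yE] := sol t.
  have := step _ _ _ _ Sxt Ywt Ttt (Dd t).
  by rewrite -yE -xS -wS -thS.
(* With the estimate exact from [T] on, the trajectory restarted at [T] solves the nominal loop for
   the shifted sequence [d]. *)
have decay t : enorm (x (T + t)%N - xs)
    <= M * expR (- (sigma * t%:R)) * enorm (x T - xs).
  have := HM (fun t => d (T + t)%N) (fun t => x (T + t)%N).
  rewrite addn0; apply=> //; first by have [] := I T.
  move=> j; rewrite addnS; have [-> yE] := sol (T + j)%N.
  by rewrite est ?leq_addr// yE.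
have CE_ge0 : 0 <= C ^+ (T + p) * E 0%N by rewrite mulr_ge0 ?exprn_ge0.
have xT : enorm (x T - xs) <= C ^+ (T + p) * E 0%N.
  apply: le_trans (growth (T + p)%N T (leq_addr _ _)).
  rewrite /E/loop_error -addrA lerDl addr_ge0 ?enorm_ge0//.
  by apply: sumr_ge0 => i _; exact: enorm_ge0.
move=> t; rewrite -/(E t) -/(E 0%N).
have -> : K * C ^+ (T + p) * expR (sigma * (T + p)%:R) * expR (- (sigma * t%:R))
    * E 0%N = K * expR (sigma * ((T + p)%:R - t%:R)) * (C ^+ (T + p) * E 0%N).
  by rewrite mulrBr expRD; ring.
(* Up to [T + p] the exponent [sigma * (T + p - t)] is nonnegative, so growth alone suffices. *)
have [tT|tT] := leqP t (T + p).
  apply: le_trans (growth _ _ tT) _; rewrite -[leLHS]mul1r ler_wpM2r//.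
  rewrite -[leLHS]mul1r ler_pM//.
    by rewrite lerDr mulr_ge0 ?addr_ge0 ?mulr_ge0// ltW.
  by rewrite -[leLHS]expR0 ler_expR mulr_ge0 ?subr_ge0 ?ler_nat ?(ltW sigma_gt0).
(* One bound for all delays up to [p]: here [t - j >= T], and the factor [expR (sigma * p)] absorbs
   the delay. Delay 0 gives the state, delay [i + 1] the output in row [i]. *)
have xle j : (j <= p)%N -> enorm (x (t - j)%N - xs)
    <= M * (expR (sigma * ((T + p)%:R - t%:R)) * (C ^+ (T + p) * E 0%N)).
  move=> jp; have Ttj : (T <= t - j)%N by clear -tT jp; lia.
  have := decay (t - j - T)%N; rewrite subnKC// => /le_trans; apply.
  rewrite -mulrA (ler_wpM2l (ltW M_gt0))// ler_pM ?enorm_ge0 ?expR_ge0//.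
  rewrite ler_expR -mulrN (ler_wpM2l (ltW sigma_gt0))//.
  have tE : (t = T + j + (t - j - T))%N by clear -tT jp; lia.
  rewrite {2}tE !natrD.
  have := jp; rewrite -(ler_nat R); lra.
rewrite /E/loop_error est ?subrr ?enorm0 ?addr0; last by lia.
set B := expR _ * _ in xle *.
have B_ge0 : 0 <= B by rewrite mulr_ge0 ?expR_ge0.
rewrite -mulrA -/B; apply: (@le_trans _ _ (M * B + p%:R * (C * (M * B)))).
  rewrite lerD//; first by have := xle 0%N; rewrite subn0; exact.
  rewrite -[p in leRHS]card_ord -sum1_card natr_sum mulr_suml.
  apply: ler_sum => i _; rewrite mul1r (row_shift_register wS); last first.
    by have := ltn_ord i; lia.
  have [_ ->] := sol (t - i.+1)%N.
  have [Sxi _ _] := I (t - i.+1)%N.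
  apply: le_trans (out _ _ Sxi (Dd _)) _.
  by apply: ler_wpM2l => //; exact: xle.
by rewrite /K; lra.
Qed.
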